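(* Let $R$ be a zero-sum free semiring with only trivial idempotent pairs, and $M$ be a free module over $R$. For any two bases $S,S'$ of $M$, there is a bijection $f:S\to S'$ such that $f(v)$ is a unit multiple of $v$ for each $v\in S$. In particular, the basis is unique up to rescaling and permutation.
   Context: A semiring is a set with $+,\cdot$ satisfying the axioms of a commutative ring except existence of additive inverses, with $0\neq 1$. $R$ is zero-sum free if $a+b=0$ implies $a=b=0$. An idempotent pair is a pair $(e,f)$ in $R$ with $ef=0$ and $e+f=1$; it is nontrivial if $e,f\notin\{0,1\}$, and trivial otherwise. A subset of an $R$-module $M$ is linearly independent if for any finitely many distinct elements $x_1,\dots,x_n$ of it, $\sum a_ix_i=\sum b_ix_i$ with $a_i,b_i\in R$ implies $a_i=b_i$ for all $i$. A basis of $M$ is a linearly independent generating set, and $M$ is free if it has a basis (bases are allowed to be infinite). *)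

(* Defs.v *)
From mathcomp Require Import all_boot all_algebra.
From mathcomp Require Import boolp classical_sets functions.

Set Implicit Arguments.
Unset Strict Implicit.
Unset Printing Implicit Defensive.

Import GRing.Theory.

Local Open Scope classical_set_scope.
Local Open Scope ring_scope.

Section Semirings.
Variable R : comNzSemiRingType.

Definition zero_sum_free : Prop :=
  forall a b : R, a + b = 0 -> a = 0 /\ b = 0.

Definition idempotent_pair (e f : R) : Prop := e * f = 0 /\ e + f = 1.

Definition nontrivial_pair (e f : R) : Prop :=
  e \notin [:: 0; 1] /\ f \notin [:: 0; 1].

Definition only_trivial_idempotent_pairs : Prop :=
  forall e f : R, idempotent_pair e f -> ~ nontrivial_pair e f.

(* [GRing.unit] requires a ring with subtraction, so it does not apply here. *)
Definition semiring_unit (u : R) : Prop := exists w : R, u * w = 1.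

End Semirings.

Section Modules.
Variables (R : comNzSemiRingType) (M : lSemiModType R).

Definition lin_indep (S : set M) : Prop :=
  forall (n : nat) (x : 'I_n -> M), injective x -> (forall i, S (x i)) ->
  forall a b : 'I_n -> R,
    \sum_(i < n) a i *: x i = \sum_(i < n) b i *: x i ->
    forall i, a i = b i.

Definition generating (S : set M) : Prop :=
  forall m : M, exists (n : nat) (x : 'I_n -> M) (a : 'I_n -> R),
    (forall i, S (x i)) /\ m = \sum_(i < n) a i *: x i.

Definition is_basis (S : set M) : Prop := lin_indep S /\ generating S.

Definition is_free : Prop := exists S : set M, is_basis S.

(* A basis is an unordered set, so being equal up to rescaling and permutation
   means being the image of the other one under a rescaling of its elements. *)
Definition is_rescaling (S S' : set M) : Prop :=
  exists u : M -> R, (forall v, S v -> semiring_unit (u v)) /\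
    S' = [set u v *: v | v in S].

End Modules.

Arguments zero_sum_free R : clear implicits.
Arguments only_trivial_idempotent_pairs R : clear implicits.
Arguments is_free {R} M.

(* Main.v *)
(** Expand each v in S over S', and each w in S' over S, with coefficients
    a v w and b w v.  Reading off the coefficient of w' <> w in the expansion
    of w and using zero-sum-freeness gives b w v * a v w' = 0.  So the terms of
    1 = \sum_w a v w * b w v are pairwise orthogonal, hence each belongs to an
    idempotent pair and is 0 or 1.  If a v w * b w v = 1, then b w v is a unit
    killing all the other a v w', so v = a v w *: w. *)
Require Import Defs.
From mathcomp Require Import all_boot all_algebra.
From mathcomp Require Import boolp classical_sets functions.

Set Implicit Arguments.
Unset Strict Implicit.
Unset Printing Implicit Defensive.

Local Open Scope classical_set_scope.
Local Open Scope ring_scope.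

Import GRing.Theory.

Section Semiring.
Variable R : comNzSemiRingType.
Hypothesis hzsf : zero_sum_free R.

Lemma zero_sum_free_sum (T : eqType) (s : seq T) (F : T -> R) :
  \sum_(x <- s) F x = 0 -> forall x, x \in s -> F x = 0.
Proof.
elim: s => [//|y s IHs]; rewrite big_cons => /hzsf[Fy0 /IHs Fs0] x.
by rewrite inE => /orP[/eqP->|/Fs0].
Qed.

(** A pair may be trivial through [f] alone; then [f = 0] forces [e = 1] by the sum, and [f = 1]
    forces [e = 0] by the product. *)
Lemma idempotent_pair_trivial (e f : R) :
  only_trivial_idempotent_pairs R -> idempotent_pair e f -> e = 0 \/ e = 1.
Proof.
move=> hidem ef; have [ef0 ef1] := ef; have := hidem e f ef.
rewrite /nontrivial_pair !inE.
have [->|e0] := eqVneq e 0; first by left.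
have [->|e1] := eqVneq e 1; first by right.
have [f0|f0] := eqVneq f 0; first by move: e1; rewrite -ef1 f0 addr0 eqxx.
have [f1|f1] := eqVneq f 1; first by move: e0; rewrite -ef0 f1 mulr1 eqxx.
by case.
Qed.

Lemma orthogonal_sum1 (T : eqType) (s : seq T) (e : T -> R) :
    only_trivial_idempotent_pairs R -> uniq s ->
    (forall x y, x \in s -> y \in s -> x != y -> e x * e y = 0) ->
  \sum_(x <- s) e x = 1 -> exists2 x, x \in s & e x = 1.
Proof.
move=> hidem us orth sum1.
have [/hasP[x xs /eqP ex1]|/hasPn ne1] := boolP (has (fun x => e x == 1) s).
  by exists x.
(* If no term is 1, all of them vanish, each being complementary to the sum of the others. *)
suff : (1 : R) == 0 by rewrite oner_eq0.
rewrite -sum1 big_seq big1 // => x xs.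
have [//|ex1] : e x = 0 \/ e x = 1; last by move: (ne1 x xs); rewrite ex1 eqxx.
apply: (idempotent_pair_trivial (f := \sum_(y <- s | y != x) e y)) => //.
split; last by rewrite -(bigD1_seq x).
rewrite mulr_sumr big_seq_cond big1 // => y /andP[ys yx].
by apply: orth; rewrite // eq_sym.
Qed.

End Semiring.

Section Coordinates.
Variables (R : comNzSemiRingType) (M : lSemiModType R) (S : set M).

(** The finite support stays existential and [c] is total, so expansions over different lists can be
    compared as plain functions. *)
Definition coordinates (m : M) (c : M -> R) : Prop :=
  exists s : seq M, [/\ uniq s, forall x, x \in s -> S x,
    forall x, x \notin s -> c x = 0 & m = \sum_(x <- s) c x *: x].

Lemma coordinates_widen (s t : seq M) (c : M -> R) :
    uniq s -> uniq t -> {subset s <= t} -> (forall x, x \notin s -> c x = 0) ->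
  \sum_(x <- s) c x *: x = \sum_(x <- t) c x *: x.
Proof.
move=> us ut st c0; rewrite [RHS](bigID (mem s)) /= [X in _ + X]big1 ?addr0.
  rewrite -[RHS]big_filter; apply/perm_big/uniq_perm; rewrite ?filter_uniq //.
  by move=> x; rewrite mem_filter; case: (boolP (x \in s)) => // /st.
by move=> x /c0 ->; rewrite scale0r.
Qed.

Lemma coordinates_common (m n : M) (c d : M -> R) :
    coordinates m c -> coordinates n d ->
  exists s : seq M, [/\ uniq s, forall x, x \in s -> S x,
    forall x, x \notin s -> c x = 0 /\ d x = 0,
    m = \sum_(x <- s) c x *: x & n = \sum_(x <- s) d x *: x].
Proof.
move=> [s [us sS c0 ->]] [t [ut tS d0 ->]].
exists (undup (s ++ t)); split; first exact: undup_uniq.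
- by move=> x; rewrite mem_undup mem_cat => /orP[/sS|/tS].
- by move=> x; rewrite mem_undup mem_cat negb_or => /andP[/c0 -> /d0 ->].
- apply: coordinates_widen; rewrite ?undup_uniq // => x xs.
  by rewrite mem_undup mem_cat xs.
- apply: coordinates_widen; rewrite ?undup_uniq // => x xt.
  by rewrite mem_undup mem_cat xt orbT.
Qed.

Lemma coordinates_unique (m : M) (c d : M -> R) :
  lin_indep S -> coordinates m c -> coordinates m d -> c = d.
Proof.
move=> indS cm dm; apply/funext => x.
have [s [us sS out0 mc md]] := coordinates_common cm dm.
have [xs|/out0[-> ->] //] := boolP (x \in s).
have xsn : (index x s < size s)%N by rewrite index_mem.
(* Indexing the common duplicate-free list gives the injective family that [lin_indep] asks for. *)
have inj_nth : injective (fun i : 'I_(size s) => nth 0 s i).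
  by move=> i j /eqP; rewrite nth_uniq // => /eqP/val_inj.
have := indS _ _ inj_nth (fun i => sS _ (mem_nth 0 (ltn_ord i)))
  (fun i => c (nth 0 s i)) (fun i => d (nth 0 s i)).
move: mc; rewrite md !(big_nth 0 (r := s)) !big_mkord => -> /(_ erefl (Ordinal xsn)) /=.
by rewrite nth_index.
Qed.

Lemma coordinates_exists (m : M) : generating S -> exists c, coordinates m c.
Proof.
move=> /(_ m)[n [x [a [xS ->]]]].
(* The generating family may repeat vectors, so the coefficients of equal ones are added up. *)
exists (fun y => \sum_(i < n | x i == y) a i), (undup (codom x)).
split; first exact: undup_uniq.
- by move=> y; rewrite mem_undup => /codomP[i ->].
- move=> y; rewrite mem_undup => yx; apply: big1 => i /eqP xiy.
  by move: yx; rewrite -xiy codom_f.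
under [RHS]eq_bigr => y _ do rewrite scaler_suml big_mkcond /=.
rewrite exchange_big /=; apply: eq_bigr => i _.
rewrite (bigD1_seq (x i)) ?undup_uniq ?mem_undup ?codom_f //= eqxx.
by rewrite big1 ?addr0 // => y; rewrite eq_sym => /negbTE ->.
Qed.

Lemma coordinates_linear (m n : M) (c d : M -> R) (a : R) :
    coordinates m c -> coordinates n d ->
  coordinates (a *: m + n) (fun x => a * c x + d x).
Proof.
move=> cm dn; have [s [us sS out0 -> ->]] := coordinates_common cm dn.
exists s; split => //; first by move=> x /out0[-> ->]; rewrite mulr0 addr0.
rewrite scaler_sumr -big_split /=; apply: eq_bigr => x _.
by rewrite scalerDl scalerA.
Qed.

Lemma coordinates0 : coordinates 0 (fun=> 0).
Proof. by exists [::]; split=> //; rewrite big_nil. Qed.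

Lemma coordinates_basis (v : M) : S v -> coordinates v (fun x => (v == x)%:R).
Proof.
move=> Sv; exists [:: v]; split=> //.
- by move=> x; rewrite inE => /eqP->.
- by move=> x; rewrite inE eq_sym => /negbTE->.
- by rewrite big_seq1 eqxx scale1r.
Qed.

(** Serves to re-expand an expansion over one basis in terms of another, like a product of
    transition matrices. *)
Lemma coordinates_sum (s : seq M) (a : M -> R) (c : M -> M -> R) :
    (forall m, coordinates m (c m)) ->
  coordinates (\sum_(x <- s) a x *: x) (fun y => \sum_(x <- s) a x * c x y).
Proof.
move=> cP; elim: s => [|x s IHs].
  under [X in coordinates _ X]eq_fun => y do rewrite big_nil.
  by rewrite big_nil; exact: coordinates0.
under [X in coordinates _ X]eq_fun => y do rewrite big_cons.
by rewrite big_cons; exact: coordinates_linear.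
Qed.

End Coordinates.

Section Bases.
Variables (R : comNzSemiRingType) (M : lSemiModType R).
Hypothesis hzsf : zero_sum_free R.
Hypothesis hidem : only_trivial_idempotent_pairs R.

Lemma basis_unit_multiple (S S' : set M) (v : M) :
    is_basis S -> is_basis S' -> S v ->
  exists w u, [/\ S' w, semiring_unit u & w = u *: v].
Proof.
move=> [indS genS] [indS' genS'] Sv.
have [b bP] := choice (fun m => coordinates_exists m genS).
have [a aP] := choice (fun m => coordinates_exists m genS').
have ba0 w w' : S' w -> w != w' -> b w v * a v w' = 0.
  move=> Sw ww'; have [t [ut tS b0 wE]] := bP w.
  have [vt|/b0 ->] := boolP (v \in t); last by rewrite mul0r.
  apply: (zero_sum_free_sum hzsf (F := fun x => b w x * a x w') (s := t)) => //.
  have := coordinates_sum t (b w) aP; rewrite -wE => cw.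
  have /(congr1 (@^~ w')) /= -> := coordinates_unique indS' cw
    (coordinates_basis Sw).
  by rewrite (negbTE ww').
have [s [us sS' _ vE]] := aP v.
have [||w ws ab1] := orthogonal_sum1 (e := fun w => a v w * b w v) hidem us.
- move=> x y xs _ xy /=.
  (* Regrouping exposes the factor [b x v * a v y], which [ba0] kills. *)
  rewrite [a v x * _]mulrC mulrACA ba0 ?mul0r //; exact: sS'.
- have := coordinates_sum s (a v) bP; rewrite -vE => cv.
  have /(congr1 (@^~ v)) /= -> := coordinates_unique indS cv
    (coordinates_basis Sv).
  by rewrite eqxx.
exists w, (b w v); split; first exact: sS'.
  by exists (a v w); rewrite mulrC.
rewrite {2}vE (bigD1_seq w) //= scalerDr scalerA [b w v * _]mulrC ab1 scale1r.
rewrite big1 ?scaler0 ?addr0 //.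
(* Writing 1 as [a v w * b w v] brings in the factor [b w v * a v w']. *)
move=> w' w'w; rewrite -[a v w']mulr1 -ab1 mulrCA [a v w' * _]mulrC ba0.
- by rewrite mulr0 scale0r.
- exact: sS'.
- by rewrite eq_sym.
Qed.

(** If [v] and [w] differed, the coordinate of [u *: v] at [w] would be 0, while that of [w] is 1.
    This yields both injectivity and surjectivity of the bijection. *)
Lemma basis_multiple_eq (S : set M) (v w : M) (u : R) :
  lin_indep S -> S v -> S w -> w = u *: v -> w = v.
Proof.
move=> indS Sv Sw wE.
have := coordinates_linear u (coordinates_basis Sv) (coordinates0 S).
rewrite -wE addr0 => cw.
have /(congr1 (@^~ w)) /= := coordinates_unique indS cw
  (coordinates_basis Sw).
have [->//|_] := eqVneq v w.
by rewrite mulr0 addr0 eqxx => /eqP; rewrite eq_sym oner_eq0.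
Qed.

End Bases.

Theorem proposition3p15 (R : comNzSemiRingType)
    (hzsf : zero_sum_free R) (hidem : only_trivial_idempotent_pairs R)
    (M : lSemiModType R) (hfree : is_free M)
    (S S' : set M) (hS : is_basis S) (hS' : is_basis S') :
  (exists f : M -> M, set_bij S S' f /\
     forall v, S v -> exists u : R, semiring_unit u /\ f v = u *: v) /\
  is_rescaling S S'.
Proof.
have /choice[p pP] : forall v : M, exists p : M * R,
    S v -> [/\ S' p.1, semiring_unit p.2 & p.1 = p.2 *: v].
  (* Outside [S] the value is arbitrary. *)
  move=> v; have [Sv|nSv] := pselect (S v); last by exists (0, 0).
  have [w [u wu]] := basis_unit_multiple hzsf hidem hS hS' Sv.
  by exists (w, u).
(* With the bases swapped, [w] has a multiple [v] in [S]; the image of [v] is then a multiple of [w]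
   inside [S'], hence [w] itself. *)
have surj w : S' w -> exists2 v, S v & (p v).1 = w.
  move=> Sw'; have [v [u [Sv _ vE]]] :=
    basis_unit_multiple hzsf hidem hS' hS Sw'.
  exists v => //; have [Sp _ pE] := pP v Sv.
  apply: (basis_multiple_eq (u := (p v).2 * u) hS'.1) => //.
  by rewrite -scalerA -vE.
split.
  exists (fun v => (p v).1); split; last first.
    by move=> v /pP[_ up pE]; exists (p v).2.
  split.
  - by move=> v /pP[].
  - move=> v w /set_mem Sv /set_mem Sw pvw.
    have [_ [r ur] vE] := pP v Sv; have [_ _ wE] := pP w Sw.
    (* As [r] inverts the scalar of [v], applying it to the common image recovers [v] as a multiple
       of [w]. *)
    apply: (basis_multiple_eq (u := r * (p w).2) hS.1) => //.
    by rewrite -scalerA -wE -pvw vE scalerA mulrC ur scale1r.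
  - by move=> w /surj[v Sv pv]; exists v.
exists (fun v => (p v).2); split; first by move=> v /pP[].
apply/seteqP; split=> [w /surj[v Sv <-]|_ [v /pP[Sp _ pE] <-]].
  by exists v => //; have [_ _ ->] := pP v Sv.
by rewrite -pE.
Qed.
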